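(* Let $p$ be a prime, $G$ a finite group, $F$ an algebraically closed field of characteristic $p$, and $B$ a block of the group algebra $FG$ with defect group $D$. Let $p^{d}=|D|$ and let $p^{\varepsilon}$ be the exponent of $D$. Then \[ LL(\mathbf{Z}B) \le p^{d} - p^{d-\varepsilon} + 1. \]
   Context: For a finite-dimensional $F$-algebra $A$, $\mathbf{J}A$ denotes its Jacobson radical and $LL(A)$ its Loewy length, i.e. the smallest integer $n\ge 1$ with $(\mathbf{J}A)^{n}=0$. $\mathbf{Z}B$ denotes the center of the block algebra $B$. *)

(* Defs.v *)
(* Concrete model of the group algebra FG of a finite group G
   over a field F: elements are functions a : gT -> F supported on G,
   a = \sum_(x in G) a x * x. *)
From HB Require Import structures.
From mathcomp Require Import all_boot all_order all_algebra all_fingroup all_solvable.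
Set Implicit Arguments. Unset Strict Implicit. Unset Printing Implicit Defensive.
Import GRing.Theory.
Local Open Scope ring_scope.

Section GroupAlgebra.
Variables (F : fieldType) (gT : finGroupType) (G : {group gT}).

Definition gzero : {ffun gT -> F} := [ffun _ => 0%R].

Definition inFG (a : {ffun gT -> F}) : Prop := forall x, x \notin G -> a x = 0%R.

Definition gmul (a b : {ffun gT -> F}) : {ffun gT -> F} :=
  [ffun x => (\sum_(y : gT) a y * b (y^-1 * x)%g)%R].

Definition gone : {ffun gT -> F} := [ffun x => ((x == 1%g)%:R)%R].

Definition gsub (a b : {ffun gT -> F}) : {ffun gT -> F} := [ffun x => (a x - b x)%R].

(* g a g^-1 for g in G *)
Definition gconj (a : {ffun gT -> F}) (g : gT) : {ffun gT -> F} :=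
  [ffun y => a (y ^ g)%g].

Definition inZFG (a : {ffun gT -> F}) : Prop :=
  inFG a /\ forall b, inFG b -> gmul a b = gmul b a.

Definition idem (a : {ffun gT -> F}) : Prop := gmul a a = a.

(* central primitive idempotent (block idempotent): B = FG e is a block *)
Definition block_idem (e : {ffun gT -> F}) : Prop :=
  [/\ inZFG e, idem e, e <> gzero &
      forall e1 e2, inZFG e1 -> inZFG e2 -> idem e1 -> idem e2 ->
        gmul e1 e2 = gzero -> e = [ffun x => (e1 x + e2 x)%R] ->
        e1 = gzero \/ e2 = gzero].

Definition inFG_fix (H : {group gT}) (a : {ffun gT -> F}) : Prop :=
  inFG a /\ forall h, h \in H -> gconj a h = a.

(* relative trace Tr_H^G(a) = \sum_(g in G/H) g a g^-1 (left coset reps) *)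
Definition rtrace (H : {group gT}) (a : {ffun gT -> F}) : {ffun gT -> F} :=
  [ffun y => (\sum_(C in lcosets H G) a (y ^ repr C)%g)%R].

Definition in_rel_trace (H : {group gT}) (e : {ffun gT -> F}) : Prop :=
  exists a, inFG_fix H a /\ e = rtrace H a.

(* D is a defect group of the block with idempotent e (Green):
   a minimal subgroup H of G with e in Tr_H^G((FG)^H) *)
Definition defect_group (e : {ffun gT -> F}) (D : {group gT}) : Prop :=
  [/\ D \subset G, in_rel_trace D e &
      forall H : {group gT}, H \subset D -> in_rel_trace H e -> H = D].

(* Z(B) = Z(FG) e *)
Definition inZB (e a : {ffun gT -> F}) : Prop := inZFG a /\ gmul a e = a.

(* Jacobson radical of the commutative algebra Z(B) (identity e):
   x such that e - y x is a unit of Z(B) for all y in Z(B) *)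
Definition inJZB (e x : {ffun gT -> F}) : Prop :=
  inZB e x /\ forall y, inZB e y ->
    exists z, inZB e z /\ gmul (gsub e (gmul y x)) z = e.

Definition JZB_pow_zero (e : {ffun gT -> F}) (n : nat) : Prop :=
  forall s : seq {ffun gT -> F}, size s = n -> (forall x, x \in s -> inJZB e x) ->
    foldr gmul gone s = gzero.

Definition is_LL_ZB (e : {ffun gT -> F}) (n : nat) : Prop :=
  [/\ (1 <= n)%N, JZB_pow_zero e n &
      forall m, (1 <= m)%N -> JZB_pow_zero e m -> (n <= m)%N].

End GroupAlgebra.

(* Main.v *)
(* Let z_1, ..., z_m be nilpotent central elements, m = p^d - p^(d - eps), put
   w = z_1 ... z_m e, and let z be one more nilpotent central element.  A central
   element that is constant on p-sections lies in the Reynolds ideal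
   Soc(FG) :&: Z(FG), which z annihilates; so it suffices to show w(ux) = w(x) for
   every p-element u and x in C = C_G(u).  Let #[u] = p^k.  The Brauer map
   (restriction to C) is multiplicative on Z(FG).  By induction on |G| applied to
   C / <u>, p^(d - k) nilpotent central factors already give 0 in F[C / <u>], that
   is, raise the (u - 1)-adic order by one.  Since
   p^(d - k) (p^k - 1) <= m, the image of w is in (u - 1)^(p^k - 1) FC and hence
   is killed by u - 1.
   Defect groups enter only through the supports of the idempotents: a p-subgroup
   of C_G(x) with e x != 0 is conjugate into D, and this condition passes to
   C_G(u) and to C_G(u) / <u>. *)
Require Import Defs.
From HB Require Import structures.
From mathcomp Require Import all_boot all_order all_algebra all_fingroup all_solvable all_field.
From Stdlib Require Import Classical.
Import GRing.Theory.
Set Implicit Arguments. Unset Strict Implicit. Unset Printing Implicit Defensive.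
Local Open Scope ring_scope.

(* An alias, so that [*] is the convolution [gmul]: on the bare type
   [{ffun gT -> F}] it would be the pointwise product. *)
Definition galg (F : fieldType) (gT : finGroupType) := {ffun gT -> F}.

(** * The group algebra as an [F]-algebra under convolution *)

Section Ring.
Variables (F : fieldType) (gT : finGroupType).
Local Notation A := (galg F gT).

(** Taking values in [F^o] supplies a finite-dimensional vector space structure, on which the
    dimension count in [galg_algebraic] rests. *)
HB.instance Definition _ := Vector.copy (galg F gT) {ffun gT -> F^o}.

Lemma galgP (a b : A) : (forall x, a x = b x) <-> a = b.
Proof. by split=> [H | ->//]; apply/ffunP. Qed.

Lemma galg0 x : (0 : A) x = 0. Proof. exact: ffunE. Qed.
Lemma galgD (a b : A) x : (a + b) x = a x + b x. Proof. exact: ffunE. Qed.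
Lemma galgN (a : A) x : (- a) x = - a x. Proof. exact: ffunE. Qed.
Lemma galgB (a b : A) x : (a - b) x = a x - b x.
Proof. by rewrite galgD galgN. Qed.
Lemma galgZ c (a : A) x : (c *: a) x = c * a x. Proof. exact: ffunE. Qed.
Lemma galg_sum I (r : seq I) (P : pred I) (E : I -> A) x :
  (\sum_(i <- r | P i) E i) x = \sum_(i <- r | P i) E i x.
Proof. by elim/big_rec2: _ => [|i y1 y2 _ <-]; rewrite ?galg0 ?galgD. Qed.

Lemma gmulE (a b : A) x : gmul a b x = \sum_y a y * b (y^-1 * x)%g.
Proof. exact: ffunE. Qed.

Fact gmulA : associative (@gmul F gT : A -> A -> A).
Proof.
move=> a b c; apply/galgP=> x; rewrite !gmulE.
under eq_bigr do rewrite gmulE mulr_sumr.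
under [RHS]eq_bigr do rewrite gmulE mulr_suml.
rewrite [RHS]exchange_big; apply: eq_bigr => y _ /=.
rewrite [RHS](reindex_inj (mulgI y)); apply: eq_bigr => z _ /=.
by rewrite mulKg invMg !mulgA mulrA.
Qed.

Fact gmul1l : left_id (gone F gT : A) (@gmul F gT).
Proof.
move=> a; apply/galgP=> x; rewrite gmulE (bigD1 1%g) //= big1 => [|y /negbTE ny].
  by rewrite ffunE eqxx mul1r addr0 invg1 mul1g.
by rewrite ffunE ny mul0r.
Qed.

Fact gmul1r : right_id (gone F gT : A) (@gmul F gT).
Proof.
move=> a; apply/galgP=> x; rewrite gmulE (bigD1 x) //= big1 => [|y ny].
  by rewrite ffunE mulVg eqxx mulr1 addr0.
by rewrite ffunE -eq_mulVg1 (negbTE ny) mulr0.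
Qed.

Fact gmulDl : left_distributive (@gmul F gT : A -> A -> A) +%R.
Proof.
move=> a b c; apply/galgP=> x; rewrite galgD !gmulE -big_split.
by apply: eq_bigr => y _; rewrite galgD mulrDl.
Qed.

Fact gmulDr : right_distributive (@gmul F gT : A -> A -> A) +%R.
Proof.
move=> a b c; apply/galgP=> x; rewrite galgD !gmulE -big_split.
by apply: eq_bigr => y _; rewrite galgD mulrDr.
Qed.

Fact gone_neq0 : (gone F gT : A) != 0.
Proof. by apply/eqP=> /galgP/(_ 1%g)/eqP; rewrite galg0 ffunE eqxx oner_eq0. Qed.

HB.instance Definition _ := GRing.Zmodule_isNzRing.Build (galg F gT)
  gmulA gmul1l gmul1r gmulDl gmulDr gone_neq0.

Fact gscaleAl (c : F) (a b : A) : c *: (a * b) = c *: a * b.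
Proof.
apply/galgP=> x; rewrite galgZ !gmulE mulr_sumr.
by apply: eq_bigr => y _; rewrite galgZ mulrA.
Qed.

HB.instance Definition _ := GRing.Lmodule_isLalgebra.Build F (galg F gT) gscaleAl.

Fact gscaleAr (c : F) (a b : A) : c *: (a * b) = a * (c *: b).
Proof.
apply/galgP=> x; rewrite galgZ !gmulE mulr_sumr.
by apply: eq_bigr => y _; rewrite galgZ mulrCA.
Qed.

HB.instance Definition _ := GRing.Lalgebra_isAlgebra.Build F (galg F gT) gscaleAr.

Lemma galgM (a b : A) x : (a * b) x = \sum_y a y * b (y^-1 * x)%g.
Proof. exact: ffunE. Qed.

Lemma galg1 x : (1 : A) x = (x == 1%g)%:R. Proof. exact: ffunE. Qed.

Definition gelt (g : gT) : A := [ffun x => (x == g)%:R].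

Lemma geltE g x : gelt g x = (x == g)%:R. Proof. exact: ffunE. Qed.

Lemma gelt_mulE g (a : A) x : (gelt g * a) x = a (g^-1 * x)%g.
Proof.
rewrite galgM (bigD1 g) //= big1 => [|y /negbTE ny]; rewrite geltE ?ny ?mul0r //.
by rewrite eqxx mul1r addr0.
Qed.

Lemma mul_geltE g (a : A) x : (a * gelt g) x = a (x * g^-1)%g.
Proof.
rewrite galgM (bigD1 (x * g^-1)%g) //= big1 => [|y ny].
  by rewrite geltE invMg invgK mulgKV eqxx mulr1 addr0.
rewrite geltE; case: eqP => [e|]; rewrite ?mulr0 //.
by case/eqP: ny; rewrite -e invMg invgK mulKVg.
Qed.

Lemma geltM g h : gelt (g * h)%g = gelt g * gelt h.
Proof.
by apply/galgP=> x; rewrite gelt_mulE !geltE -(inj_eq (mulgI g^-1%g)) mulKg.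
Qed.

Lemma gelt1 : gelt 1%g = 1. Proof. by apply/galgP=> x; rewrite geltE. Qed.

Lemma geltX g n : gelt (g ^+ n)%g = gelt g ^+ n.
Proof. by elim: n => [|n IH]; rewrite ?expg0 ?gelt1 // expgS exprS geltM IH. Qed.

Lemma galg_geltE (a : A) : a = \sum_x a x *: gelt x.
Proof.
apply/galgP=> x; rewrite galg_sum (bigD1 x) //= big1 => [|y /negbTE ny].
  by rewrite galgZ geltE eqxx mulr1 addr0.
by rewrite galgZ geltE eq_sym ny mulr0.
Qed.

End Ring.

(** * Elements supported on [G] and the center of [FG] *)

Section Support.
Variables (F : fieldType) (gT : finGroupType) (G : {group gT}).
Local Notation A := (galg F gT).
Implicit Types a b z : A.

Lemma galg_supp_geltE a : inFG G a -> a = \sum_(x in G) a x *: gelt F x.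
Proof.
move=> Ga; rewrite {1}[a]galg_geltE (bigID (mem G)) /= [X in _ + X]big1 ?addr0 //.
by move=> x /Ga->; rewrite scale0r.
Qed.

Lemma inFG0 : inFG G (0 : A). Proof. by move=> x _; rewrite galg0. Qed.
Lemma inFGD a b : inFG G a -> inFG G b -> inFG G (a + b).
Proof. by move=> Ga Gb x nx; rewrite galgD Ga // Gb // addr0. Qed.
Lemma inFGZ c a : inFG G a -> inFG G (c *: a).
Proof. by move=> Ga x nx; rewrite galgZ Ga // mulr0. Qed.
Lemma inFGN a : inFG G a -> inFG G (- a).
Proof. by move=> Ga x nx; rewrite galgN Ga // oppr0. Qed.
Lemma inFGB a b : inFG G a -> inFG G b -> inFG G (a - b).
Proof. by move=> Ga Gb; apply: inFGD => //; apply: inFGN. Qed.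
Lemma inFG_sum I (r : seq I) (P : pred I) (E : I -> A) :
  (forall i, P i -> inFG G (E i)) -> inFG G (\sum_(i <- r | P i) E i).
Proof. by move=> GE; apply: big_ind => //; [apply: inFG0 | apply: inFGD]. Qed.

Lemma inFG_gelt g : g \in G -> inFG G (gelt F g).
Proof. by move=> Gg x; rewrite geltE; case: eqP => // ->; rewrite Gg. Qed.

Lemma inFG1 : inFG G (1 : A). Proof. by rewrite -gelt1; apply/inFG_gelt/group1. Qed.

Lemma inFGM a b : inFG G a -> inFG G b -> inFG G (a * b).
Proof.
move=> Ga Gb x nx; rewrite galgM big1 // => y _.
case Gy: (y \in G); last by rewrite Ga ?Gy // mul0r.
by rewrite Gb ?mulr0 // groupMl ?groupV.
Qed.

Lemma inFGX a n : inFG G a -> inFG G (a ^+ n).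
Proof.
by move=> Ga; elim: n => [|n IH]; [apply: inFG1 | rewrite exprS; apply: inFGM].
Qed.

Definition gcentral z := inFG G z /\ forall b, inFG G b -> z * b = b * z.

(** Commuting with group elements forces constancy on classes. Conversely, substituting [x * y^-1]
    for the summation variable of one convolution matches it termwise with the other, because [y]
    conjugates [x * y^-1] to [y^-1 * x]. *)
Lemma gcentralP z :
  gcentral z <-> inFG G z /\ forall g x, g \in G -> z (x ^ g)%g = z x.
Proof.
split=> -[Gz Cz]; split=> //.
  move=> g x Gg; have := Cz _ (inFG_gelt Gg) => /galgP/(_ (g * (x ^ g))%g).
  by rewrite mul_geltE gelt_mulE mulKg -conjgC mulgK => ->.
move=> b Gb; apply/galgP=> x; rewrite !galgM (reindex_inj invg_inj).
rewrite (reindex_inj (mulIg x^-1%g)) /=.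
apply: eq_bigr => y _; rewrite [(_^-1)^-1%g]invgK mulgKV invMg invgK mulrC.
case Gy: (y \in G); last by rewrite [b _]Gb ?mul0r ?Gy.
by rewrite -(Cz y (x * y^-1)%g Gy) conjgE mulgKV.
Qed.

Lemma gcentral0 : gcentral 0.
Proof. by split=> [|b _]; [apply: inFG0 | rewrite mul0r mulr0]. Qed.
Lemma gcentral1 : gcentral 1.
Proof. by split=> [|b _]; [apply: inFG1 | rewrite mul1r mulr1]. Qed.
Lemma gcentralM a b : gcentral a -> gcentral b -> gcentral (a * b).
Proof.
move=> [Ga Ca] [Gb Cb]; split=> [|c Gc]; first exact: inFGM.
by rewrite -mulrA Cb // mulrA Ca // mulrA.
Qed.
Lemma gcentralD a b : gcentral a -> gcentral b -> gcentral (a + b).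
Proof.
move=> [Ga Ca] [Gb Cb]; split=> [|c Gc]; first exact: inFGD.
by rewrite mulrDl mulrDr Ca // Cb.
Qed.
Lemma gcentralZ c a : gcentral a -> gcentral (c *: a).
Proof.
move=> [Ga Ca]; split=> [|b Gb]; first exact: inFGZ.
by rewrite -scalerAl -scalerAr Ca.
Qed.
Lemma gcentralX a n : gcentral a -> gcentral (a ^+ n).
Proof.
move=> Ca; elim: n => [|n IH]; first exact: gcentral1.
by rewrite exprS; apply: gcentralM.
Qed.
Lemma gcentral_prod (s : seq A) :
  (forall z, z \in s -> gcentral z) -> gcentral (\prod_(z <- s) z).
Proof.
move=> Cs; rewrite big_seq; apply: big_ind => //; [exact: gcentral1 | exact: gcentralM].
Qed.

End Support.

(** * Orbit sums and the Brauer map *)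

(** A non-trivial orbit of a p-group has size divisible by [p], and [W] is constant on it, so it
    contributes 0 in characteristic [p]. *)
Lemma sum_pgroup_fix (R : nzRingType) (p : nat) (aT : finGroupType)
    (T : finType) (to : {action aT &-> T}) (P : {group aT}) (S : {set T})
    (W : T -> R) :
  p \in [pchar R] -> (p.-group P)%g -> [acts P, on S | to]%g ->
  (forall x a, x \in S -> a \in P -> W (to x a) = W x) ->
  \sum_(x in S) W x = \sum_(x in 'Fix_(S | to)(P)%g) W x.
Proof.
move=> pR pP actS invW; rewrite (big_setID 'Fix_to(P)%g) /= [X in _ + X](_ : _ = 0) ?addr0 //.
have actD: [acts P, on S :\: 'Fix_to(P) | to]%g.
  rewrite actsD // -(setIidPr (subsetT P)); apply: subset_trans (acts_subnorm_fix _ _).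
  by rewrite setIS ?normG.
rewrite (set_partition_big _ (orbit_partition actD)) big1 // => _ /imsetP[x /setDP[Sx nfx] ->].
rewrite (eq_bigr (fun _ => W x)) => [|_ /imsetP[a Pa ->]]; last exact: invW.
rewrite sumr_const.
have [k oPx]: {k | #|orbit to P x| = (p ^ k)%N}.
  by apply: p_natP; apply: pnat_dvd pP; rewrite card_orbit_in ?dvdn_indexg ?subsetT.
case: k oPx => [/card_orbit1 fix_x | k ->]; last first.
  by rewrite expnS mulrnA (mulrn_pchar pR) mul0rn.
by case/afixP: nfx => a Pa; apply/set1P; rewrite -fix_x mem_orbit.
Qed.

Section Brauer.
Variables (F : fieldType) (p : nat) (gT : finGroupType).
Hypothesis pF : p \in [pchar F].
Local Notation A := (galg F gT).

(** For [H = 'C[u]] this is the Brauer map; truncation by zeros keeps the image in the same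
    algebra. *)
Definition gres (H : {set gT}) (a : A) : A := [ffun x => if x \in H then a x else 0].

Lemma gresE H a x : gres H a x = if x \in H then a x else 0.
Proof. exact: ffunE. Qed.

Lemma gres1 (H : {group gT}) : gres H 1 = 1.
Proof.
by apply/galgP=> x; rewrite gresE galg1; case: eqP => [->|_]; rewrite ?group1 ?if_same.
Qed.

(** For [x] in ['C[u]], conjugation by [<[u]>] permutes the factorizations of [x] and preserves
    their summands; the fixed ones have both factors in ['C[u]]. For other [x] no factorization
    inside ['C[u]] exists. *)
Lemma gresM u (a b : A) : (p.-elt u)%g ->
  (forall x, a (x ^ u)%g = a x) -> (forall x, b (x ^ u)%g = b x) ->
  gres 'C[u]%g (a * b) = gres 'C[u]%g a * gres 'C[u]%g b.
Proof.
move=> pu ua ub; apply/galgP=> x; rewrite gresE !galgM.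
have iterJ (c : A) (uc : forall x, c (x ^ u)%g = c x) g y : g \in <[u]>%g -> c (y ^ g)%g = c y.
  case/cycleP=> i ->; elim: i y => [|i IH] y; first by rewrite expg0 conjg1.
  by rewrite expgSr conjgM uc IH.
case: ifP => [Cx | nCx]; last first.
  rewrite big1 // => y _; rewrite !gresE; case: ifP => Cy; rewrite ?mul0r //.
  by rewrite groupMl ?groupV // nCx mulr0.
have -> : \sum_y a y * b (y^-1 * x)%g = \sum_(y in [set: gT]) a y * b (y^-1 * x)%g.
  by apply: eq_bigl => y; rewrite inE.
rewrite (sum_pgroup_fix (p := p) (to := 'J%act) (P := <[u]>%G)) //.
- rewrite [RHS](bigID (mem 'C[u]%g)) /= [X in _ = _ + X]big1 => [|y nCy]; last first.
    by rewrite gresE (negbTE nCy) mul0r.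
  rewrite addr0; apply: eq_big => [y | y].
    by rewrite inE inE /= afixJ cent_cycle.
  rewrite inE inE /= afixJ cent_cycle => Cy.
  by rewrite !gresE Cy groupMl ?groupV // Cx.
- by apply/actsP=> g _ y; rewrite !inE.
move=> y g _ Ug /=; rewrite iterJ //; congr (_ * _).
rewrite -[RHS](iterJ _ ub g) // conjMg conjVg; congr (b (_ * _)%g).
apply/esym/conjg_fixP/commgP; case/cycleP: Ug => i ->; apply/commuteX.
exact/cent1P.
Qed.

Section Central.
Variables (G : {group gT}) (u : gT).
Hypotheses (Gu : u \in G) (pu : (p.-elt u)%g).

Lemma gcentral_gres z : gcentral G z -> gcentral 'C_G[u] (gres 'C[u]%g z).
Proof.
move/gcentralP=> [Gz Jz]; apply/gcentralP; split=> [x|g x /setIP[Gg Cg]].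
  by rewrite inE gresE; case: ifP => //; rewrite andbT => _; apply: Gz.
by rewrite !gresE Jz // memJ_norm // (subsetP (normG _)).
Qed.

Lemma gcentral_gresM a b : gcentral G a -> gcentral G b ->
  gres 'C[u]%g (a * b) = gres 'C[u]%g a * gres 'C[u]%g b.
Proof.
by move=> /gcentralP[_ Ja] /gcentralP[_ Jb]; apply: gresM => // x; rewrite (Ja, Jb).
Qed.

Lemma gres_prod (s : seq A) : (forall a, a \in s -> gcentral G a) ->
  gres 'C[u]%g (\prod_(a <- s) a) = \prod_(a <- map (gres 'C[u]%g) s) a.
Proof.
elim: s => [|a s IH] Cs; first by rewrite !big_nil gres1.
have Cs' b : b \in s -> gcentral G b by move=> sb; apply: Cs; rewrite inE sb orbT.
rewrite /= !big_cons gcentral_gresM ?IH //; first by apply: Cs; rewrite mem_head.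
exact: gcentral_prod.
Qed.

Lemma gresX a n : gcentral G a -> gres 'C[u]%g (a ^+ n) = gres 'C[u]%g a ^+ n.
Proof.
move=> Ca; elim: n => [|n IH]; first by rewrite !expr0 gres1.
by rewrite !exprS gcentral_gresM ?IH //; apply: gcentralX.
Qed.

End Central.

End Brauer.

(** * Annihilation of the Reynolds ideal *)

Section Reynolds.
Variables (F : fieldType) (gT : finGroupType) (G : {group gT}).
Local Notation A := (galg F gT).

Lemma gelt_prod n (t : 'I_n -> gT) (c : 'I_n -> F) :
  \prod_i (c i *: gelt F (t i)) = (\prod_i c i) *: gelt F (\prod_i t i)%g.
Proof.
elim/big_rec3: _ => [|i x y z _ ->]; first by rewrite gelt1 scale1r.
by rewrite geltM -scalerAl -scalerAr scalerA.
Qed.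

(* The p-tuples with product in a given class are permuted by rotation, and the
   non-constant ones contribute 0 in characteristic p. *)
Lemma sum_class_prime_pow (p : nat) (h : gT -> F) (a : A) :
  p \in [pchar F] ->
  inFG G a -> (forall x g, x \in G -> g \in G -> h (x ^ g)%g = h x) ->
  \sum_(x in G) h x * (a ^+ p) x = \sum_(x in G) h (x ^+ p)%g * a x ^+ p.
Proof.
move=> pF; have p_pr := pcharf_prime pF; case: p pF p_pr => [|n] // pF p_pr Ga hJ.
pose p := n.+1.
pose W (t : {ffun 'I_p -> gT}) := h (\prod_i t i)%g * (\prod_i a (t i)).
pose S : {set {ffun 'I_p -> gT}} := [set t : {ffun 'I_p -> gT} | [forall i, t i \in G]].
have prodG (t : {ffun 'I_p -> gT}) : t \in S -> (\prod_i t i)%g \in G.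
  by rewrite inE => /forallP Gt; apply: group_prod.
have -> : \sum_(x in G) h x * (a ^+ p) x = \sum_(t in S) W t.
  have -> : a ^+ p = \sum_(t : {ffun 'I_p -> gT})
                      (\prod_i a (t i)) *: gelt F (\prod_i t i)%g.
    rewrite -{1}[p]card_ord -prodr_const.
    rewrite (eq_bigr (fun=> \sum_x a x *: gelt F x)) => [|i _]; last exact: galg_geltE.
    by rewrite bigA_distr_bigA; apply: eq_bigr => t _; rewrite gelt_prod.
  under eq_bigr do rewrite galg_sum mulr_sumr.
  rewrite exchange_big /= (bigID (mem S)) /= [X in _ + X]big1 ?addr0 => [|t nSt].
    apply: eq_bigr => t St; rewrite (bigD1 (\prod_i t i)%g) ?prodG //=.
    rewrite [X in _ + X]big1 ?addr0 => [|x /andP[_ /negbTE nx]]; last first.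
      by rewrite galgZ geltE nx !mulr0.
    by rewrite galgZ geltE eqxx mulr1.
  move: nSt; rewrite inE negb_forall => /existsP[i nGi].
  apply: big1 => x _; rewrite galgZ (bigD1 i) //= Ga // !mul0r mulr0 //.
(* Rotation generates a p-group acting on [S]; its fixed points are the constant tuples, which give
   the right-hand side. *)
pose rot (t : {ffun 'I_p -> gT}) := [ffun i => t (ordS i)].
have rot_inj : injective rot.
  move=> t1 t2 /ffunP eqt; apply/ffunP=> i; have := eqt (ord_pred i).
  by rewrite !ffunE ord_predK.
pose r := perm rot_inj.
have rE k t : (r ^+ k)%g t = [ffun i => t (iter k (@ordS p) i)].
  elim: k t => [|k IH] t; first by apply/ffunP=> i; rewrite expg0 perm1 ffunE.
  by rewrite expgS permM IH; apply/ffunP=> i; rewrite permE !ffunE iterS.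
have iterE k (i : 'I_p) : iter k (@ordS p) i = ((i + k) %% p)%N :> nat.
  elim: k => [|k IH]; first by rewrite addn0 modn_small.
  by rewrite iterS /= IH -addn1 modnDml addn1 addnS.
have pr : (p.-group <[r]>)%g.
  apply: (@pnat_dvd _ p); last by rewrite pnat_id.
  rewrite order_dvdn; apply/eqP/permP=> t; rewrite rE perm1; apply/ffunP=> i.
  by rewrite ffunE; congr (t _); apply/ord_inj; rewrite iterE modnDr modn_small.
rewrite (sum_pgroup_fix (p := p) (to := 'P%act) (P := <[r]>%G)) //.
- pose cst x : {ffun 'I_p -> gT} := [ffun=> x].
  have cst_inj : {in G &, injective cst}.
    by move=> x y _ _ /ffunP/(_ ord0); rewrite !ffunE.
  rewrite (_ : 'Fix_(S | 'P)(<[r]>)%g = cst @: G) ?big_imset //=.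
    apply: eq_bigr => x Gx; congr (h _ * _).
      by under eq_bigr do rewrite ffunE; rewrite prodg_const card_ord.
    by under eq_bigr do rewrite ffunE; rewrite prodr_const card_ord.
  apply/setP=> t; apply/setIP/imsetP=> [[St /afixP fix_t] | [x Gx ->]].
    exists (t ord0); first by move: St; rewrite inE => /forallP.
    apply/ffunP=> i; rewrite ffunE.
    have /ffunP/(_ ord0) := fix_t _ (mem_cycle r i).
    rewrite /= apermE rE ffunE => <-; congr (t _).
    by apply/ord_inj; rewrite iterE add0n modn_small.
  split; first by rewrite inE; apply/forallP=> i; rewrite ffunE.
  apply/afixP=> _ /cycleP[k ->]; rewrite /= apermE rE.
  by apply/ffunP=> i; rewrite !ffunE.
- apply/actsP=> _ /cycleP[k ->] t; rewrite /= apermE rE !inE.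
  apply/forallP/forallP=> Gt i; last by rewrite ffunE.
  have := Gt (iter k (@ord_pred p) i); rewrite ffunE.
  suff ->: iter k (@ordS p) (iter k (@ord_pred p) i) = i by [].
  elim: k {Gt} i => // k IH i; rewrite iterSr [X in ordS X]iterS ord_predK.
  exact: IH.
move=> t _ St /cycleP[k ->]; rewrite /= apermE.
elim: k t St => [|k IH] t St; first by rewrite expg0 perm1.
rewrite expgS permM permE IH; last first.
  by move: St; rewrite !inE => /forallP Gt; apply/forallP=> i; rewrite ffunE.
have eqS (i : 'I_n) : ordS (widen_ord (leqnSn n) i) = lift ord0 i.
  by apply/val_inj; rewrite /= modn_small // ltnS.
have eqM : ordS (@ord_max n) = ord0 by apply/val_inj; rewrite /= modnn.
(* Moving the first factor to the end conjugates the product by that factor, which the class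
   function [h] does not see. *)
have prodE : (\prod_i rot t i = (\prod_i t i) ^ (t ord0))%g.
  rewrite [in RHS]big_ord_recl conjgE -!mulgA mulKg big_ord_recr /= ffunE eqM.
  by congr (_ * _)%g; apply: eq_bigr => i _; rewrite ffunE eqS.
rewrite /W prodE hJ ?prodG //; last by move: St; rewrite inE => /forallP.
congr (_ * _); rewrite [RHS]big_ord_recl [LHS]big_ord_recr /= ffunE eqM mulrC.
by congr (_ * _); apply: eq_bigr => i _; rewrite ffunE eqS.
Qed.

(** Class functions that are constant on p-sections: the value at [x] depends only on the p'-part of
    [x]. *)
Definition section_stable (p : nat) (w : gT -> F) :=
  (forall x g, x \in G -> g \in G -> w (x ^ g)%g = w x) /\
  (forall u x, u \in G -> x \in G -> (p.-elt u)%g -> commute x u ->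
     w (u * x)%g = w x).

(** A suitable power of [p] is 1 modulo the p'-part of [#|G|]; raising to it fixes the p'-part of
    [x] and alters only the p-part. *)
Lemma section_stable_expg (p : nat) (w : gT -> F) : prime p -> section_stable p w ->
  exists r, forall x, x \in G -> w (x ^+ (p * r))%g = w x.
Proof.
(* Euler's theorem suggests the exponent [p ^ totient n]; one factor [p] is split off to leave
   [r]. *)
move=> p_pr [_ wp]; pose n := (#|G|`_p^')%N; exists (p ^ (totient n).-1)%N => x Gx.
rewrite -expnS prednK ?totient_gt0 ?part_gt0 //; set k := (p ^ _)%N.
have xp'k : ((x.`_p^')%g ^+ k = x.`_p^')%g.
  rewrite -[RHS]expg1; apply/eqP; rewrite eq_expg_mod_order.
  have dvdn_n : (#[x.`_p^']%g %| n)%N by rewrite order_constt partn_dvd ?order_dvdG.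
  have: k = 1 %[mod n] by apply/Euler_exp_totient/(pnat_coprime _ (part_pnat _ _)); rewrite pnat_id.
  by move/(congr1 (modn^~ #[x.`_p^']%g)); rewrite !modn_dvdm // => ->.
have Gc pi y : y \in G -> (y.`_pi)%g \in G by move=> Gy; apply: groupX.
have cx : commute (x.`_p^')%g (x.`_p)%g.
  by apply: commuteX2.
rewrite -{1}(consttC p x) expgMn; last exact: commute_sym.
have wpE y : y \in G -> (p.-elt y)%g -> commute (x.`_p^')%g y -> w (y * x.`_p^')%g = w (x.`_p^')%g.
  by move=> Gy py cxy; rewrite wp ?Gc //; apply: commute_sym.
rewrite xp'k -[in RHS](consttC p x) !wpE ?groupX ?Gc ?p_elt_constt //.
  by apply: p_eltX; apply: p_elt_constt.
exact: commuteX.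
Qed.

(** The p-th power of the sum is, by Frobenius and [sum_class_prime_pow], a sum of the same kind for
    [a ^+ p], whose nilpotency exponent is smaller; Frobenius is injective. *)
Lemma sum_nilpotent_section (p m : nat) (w : gT -> F) (a : A) :
  p \in [pchar F] -> section_stable p w -> inFG G a -> a ^+ (p ^ m) = 0 ->
  \sum_(x in G) w x * a x = 0.
Proof.
move=> pF; have p_pr := pcharf_prime pF.
elim: m w a => [|m IH] w a wst Ga am0.
  by rewrite expn0 expr1 in am0; rewrite am0 big1 // => x _; rewrite galg0 mulr0.
have [r wr] := section_stable_expg p_pr wst; case: wst => wJ wp.
(* Chosen so that [h (x ^+ p) = w x ^+ p]. *)
pose h x := w (x ^+ r)%g ^+ p.
have hJ x g : x \in G -> g \in G -> h (x ^ g)%g = h x.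
  by move=> Gx Gg; rewrite /h -conjXg wJ ?groupX.
have hst : section_stable p h.
  split=> // u x Gu Gx pu cxu; rewrite /h expgMn; last exact: commute_sym.
  by rewrite wp ?groupX ?p_eltX //; apply: commuteX2.
have := IH h (a ^+ p) hst (inFGX p Ga); rewrite -exprM -expnS => /(_ am0).
rewrite sum_class_prime_pow // => sum0; apply/eqP.
have -> : (\sum_(x in G) w x * a x == 0) = (\sum_(x in G) h (x ^+ p)%g * a x ^+ p == 0).
  rewrite -[LHS](fmorph_eq0 (pFrobenius_aut pF)) rmorph_sum; congr (_ == _).
  by apply: eq_bigr => x Gx; rewrite /= pFrobenius_autE exprMn /h -expgM wr.
by rewrite sum0 eqxx.
Qed.

(** The coefficient of [z * w] at [g] pairs [g^-1 * z], nilpotent because [z] is central, with the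
    function sending [x] to [w x^-1], again constant on p-sections. *)
Lemma nilpotent_mul_section_stable (p N : nat) (z w : A) :
  p \in [pchar F] -> gcentral G z -> z ^+ N = 0 -> inFG G w ->
  section_stable p w -> z * w = 0.
Proof.
move=> pF [Gz Cz] zN0 Gw [wJ wp]; apply/galgP=> g; rewrite galg0.
have p_pr := pcharf_prime pF.
have [Gg | nGg] := boolP (g \in G); last exact: (inFGM Gz Gw).
pose a := gelt F g^-1%g * z.
have Ga : inFG G a by apply: inFGM => //; apply/inFG_gelt; rewrite groupV.
have aN : a ^+ (p ^ N) = 0.
  rewrite exprMn_comm; last by apply/esym/Cz/inFG_gelt; rewrite groupV.
  by rewrite -(subnK (ltnW (ltn_expl N (prime_gt1 p_pr)))) [z ^+ _]exprD zN0 !mulr0.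
pose w' x := w x^-1%g.
have w'st : section_stable p w'.
  split=> [x h Gx Gh | u x Gu Gx pu cux]; rewrite /w'.
    by rewrite -conjVg wJ ?groupV.
  rewrite -cux invMg wp ?groupV ?p_eltV //.
  by apply/commuteV/commute_sym/commuteV.
rewrite -[RHS](sum_nilpotent_section pF w'st Ga aN) galgM.
rewrite (reindex_inj (mulgI g)) /= [RHS]big_mkcond; apply: eq_bigr => x _.
rewrite gelt_mulE invgK invMg mulgKV mulrC.
by case: ifP => // nGx; rewrite Gz ?mulr0 // groupMl // nGx.
Qed.

End Reynolds.

(** * The quotient by a central p-element *)

Definition nilcentral (F : fieldType) (gT : finGroupType) (G : {group gT}) (z : galg F gT) :=
  gcentral G z /\ exists n, z ^+ n = 0.

Section CentralQuotient.
Variables (F : fieldType) (gT : finGroupType) (G : {group gT}) (u : gT).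
Hypotheses (Gu : u \in G) (cGu : G \subset 'C[u]%g).
Local Notation A := (galg F gT).
Local Notation U := <[u]>%G.
Local Notation Q := (coset_of <[u]>%g).
Local Notation v := (gelt F u).
Implicit Types a b c z : A.

(** The linear extension of the projection of [G] onto [G / U]; by [gquoM] it is multiplicative on
    elements supported on [G]. *)
Definition gquo (a : A) : galg F Q := \sum_(x in G) a x *: gelt F (coset U x).

Lemma gquoE a X : gquo a X = \sum_(x in G | coset U x == X) a x.
Proof.
rewrite galg_sum [RHS]big_mkcondr; apply: eq_bigr => x _.
by rewrite galgZ geltE eq_sym; case: ifP; rewrite ?mulr1 ?mulr0.
Qed.

Fact gquo_is_linear : linear gquo.
Proof.
move=> c a b; rewrite /gquo scaler_sumr -big_split; apply: eq_bigr => x _.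
by rewrite galgD galgZ scalerDl scalerA.
Qed.

HB.instance Definition _ := GRing.isLinear.Build F A (galg F Q) _ gquo gquo_is_linear.

Lemma sub_norm_cycle : G \subset 'N(U)%g.
Proof. by rewrite cents_norm // cent_cycle. Qed.

Let morM : {in G &, {morph coset U : x y / (x * y)%g}}.
Proof. by move=> x y Gx Gy; rewrite morphM // (subsetP sub_norm_cycle). Qed.

Lemma gquo_gelt g : g \in G -> gquo (gelt F g) = gelt F (coset U g).
Proof.
move=> Gg; rewrite /gquo (bigD1 g) //= big1 ?addr0 => [|x /andP[_ /negbTE nx]].
  by rewrite geltE eqxx scale1r.
by rewrite geltE nx scale0r.
Qed.

Lemma gquoM a b : inFG G a -> inFG G b -> gquo (a * b) = gquo a * gquo b.
Proof.
move=> /galg_supp_geltE-> /galg_supp_geltE->.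
rewrite mulr_suml !raddf_sum mulr_suml; apply: eq_bigr => x Gx.
rewrite !mulr_sumr raddf_sum; apply: eq_bigr => y Gy.
rewrite /= -scalerAl -scalerAr -geltM !linearZ /= !gquo_gelt ?groupM // morM //.
by rewrite geltM -scalerAl -scalerAr.
Qed.

Lemma gquo1 : gquo 1 = 1.
Proof. by rewrite -gelt1 gquo_gelt ?group1 // morph1 gelt1. Qed.

Lemma inFG_gquo a : inFG (G / U) (gquo a).
Proof. by apply: inFG_sum => x Gx; apply/inFGZ/inFG_gelt/mem_quotient. Qed.

(** A representative in [G] of the coset [X]; the default 1 is returned only outside [G / U]. *)
Definition grep (X : Q) : gT := odflt 1%g [pick y in G | coset U y == X].

Lemma grepP X : X \in (G / U)%g -> grep X \in G /\ coset U (grep X) = X.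
Proof.
case/morphimP=> y _ Gy ->; rewrite /grep; case: pickP => [x /andP[Gx /eqP->] // | /(_ y)].
by rewrite Gy eqxx.
Qed.

Lemma gquo_surj (b : galg F Q) : inFG (G / U) b -> exists2 a : A, inFG G a & gquo a = b.
Proof.
move=> Gb; exists (\sum_(X in (G / U)%g) b X *: gelt F (grep X)).
  by apply: inFG_sum => X /grepP[Gy _]; apply/inFGZ/inFG_gelt.
rewrite raddf_sum [RHS](galg_supp_geltE Gb); apply: eq_bigr => X /grepP[Gy yX].
by rewrite /= linearZ /= gquo_gelt // yX.
Qed.

Lemma gcentral_gquo z : gcentral G z -> gcentral (G / U) (gquo z).
Proof.
move=> [Gz Cz]; split=> [|_ /gquo_surj[b Gb <-]]; first exact: inFG_gquo.
by rewrite -!gquoM // Cz.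
Qed.

Lemma gquoX a n : inFG G a -> gquo (a ^+ n) = gquo a ^+ n.
Proof.
move=> Ga; elim: n => [|n IH]; first by rewrite !expr0 gquo1.
by rewrite !exprS gquoM ?IH //; apply: inFGX.
Qed.

Lemma gquo_prod (s : seq A) : (forall a, a \in s -> inFG G a) ->
  gquo (\prod_(a <- s) a) = \prod_(a <- map gquo s) a.
Proof.
elim: s => [|a s IH] Gs; first by rewrite !big_nil gquo1.
have Gs' b : b \in s -> inFG G b by move=> sb; apply: Gs; rewrite inE sb orbT.
rewrite /= !big_cons gquoM ?IH //; first by apply: Gs; rewrite mem_head.
by rewrite big_seq; apply: big_ind => //; [apply: inFG1 | apply: inFGM].
Qed.

(** Membership in the ideal of [FG] generated by the [j]-th power of the central element [u - 1]. *)
Definition aug_mul j (a : A) := exists2 c : A, inFG G c & a = (v - 1) ^+ j * c.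

Let Gv : inFG G v. Proof. exact: inFG_gelt. Qed.
Let Gv1 : inFG G (v - 1). Proof. by apply: inFGB => //; apply: inFG1. Qed.

Lemma aug_comm j a : inFG G a -> (v - 1) ^+ j * a = a * (v - 1) ^+ j.
Proof.
move=> Ga; suff Cv : gcentral G v.
  have C1 : gcentral G (v - 1).
    by rewrite -[- 1]scaleN1r; apply/gcentralD => //; apply/gcentralZ/gcentral1.
  by have [_ ->] := gcentralX j C1.
apply/gcentralP; split=> // g x Gg; rewrite !geltE -(inj_eq (conjg_inj g) x).
congr ((_ == _)%:R); apply/esym/conjg_fixP/commgP/commute_sym/cent1P.
exact: (subsetP cGu).
Qed.

Lemma aug_mul_sum I (r : seq I) (P : pred I) j (E : I -> A) :
  (forall i, P i -> aug_mul j (E i)) -> aug_mul j (\sum_(i <- r | P i) E i).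
Proof.
move=> PE; apply: big_ind => //.
  by exists 0; rewrite ?mulr0 //; apply: inFG0.
move=> _ _ [c Gc ->] [d Gd ->]; exists (c + d); first exact: inFGD.
by rewrite mulrDr.
Qed.

(** The coefficients of [a] sum to 0 on each coset of [U], so each [x] may be replaced by its
    difference with the coset representative [y]; that difference is [(v ^+ i - 1) * y], divisible
    by [v - 1] through the geometric series. *)
Lemma gquo_eq0 a : inFG G a -> gquo a = 0 -> aug_mul 1 a.
Proof.
move=> Ga a0; have -> : a = \sum_(x in G) a x *: (gelt F x - gelt F (grep (coset U x))).
  under eq_bigr do rewrite scalerBr.
  rewrite sumrB -galg_supp_geltE // [X in _ - X](_ : _ = 0) ?subr0 //.
  rewrite (partition_big (coset U) (mem (G / U)%g)) /= => [|x Gx]; last exact: mem_quotient.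
  rewrite big1 // => X _; rewrite (eq_bigr (fun x => a x *: gelt F (grep X))).
    by rewrite -scaler_suml -gquoE a0 galg0 scale0r.
  by move=> x /andP[_ /eqP->].
apply: aug_mul_sum => x Gx; set y := grep _.
have [Gy yX] : y \in G /\ coset U y = coset U x by apply/grepP/mem_quotient.
have : (x * y^-1)%g \in U.
  apply: coset_idr; first by rewrite (subsetP sub_norm_cycle) ?groupM ?groupV.
  by rewrite morM ?groupV // morphV ?(subsetP sub_norm_cycle) //= -yX mulgV.
case/cycleP=> i xy; have {xy}-> : x = (u ^+ i * y)%g by rewrite -xy mulgKV.
exists (a (u ^+ i * y)%g *: ((\sum_(j < i) v ^+ j) * gelt F y)).
  apply/inFGZ/inFGM; last exact: inFG_gelt.
  by apply: inFG_sum => j _; apply: inFGX.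
rewrite -scalerAr expr1 mulrA -subrX1 mulrBl mul1r geltM geltX //.
Qed.

(** * Powers and annihilator of [u - 1] for a p-element [u] *)

Section PElement.
Variable p : nat.
Hypotheses (pF : p \in [pchar F]) (pu : (p.-elt u)%g).
Local Notation q := #[u]%g.

Let aug_expn_poly : ('X - 1 : {poly F}) ^+ q = 'X^q - 1.
Proof.
have pP : p \in [pchar {poly F}] by rewrite pchar_lalg.
have qP : [pchar {poly F}].-nat q by rewrite (eq_pnat _ (pcharf_eq pP)).
by rewrite exprDn_pchar // exprNn_pchar // expr1n.
Qed.

Lemma aug_expn : (v - 1) ^+ q = 0.
Proof.
have := congr1 (horner_alg v) aug_expn_poly.
rewrite !rmorphB !rmorphXn /= horner_algX rmorphB /= horner_algX rmorph1 => ->.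
by rewrite -geltX expg_order gelt1 subrr.
Qed.

(** Proved in [{poly F}] and then evaluated at [v]: there ['X - 1] can be cancelled, while [v - 1]
    is nilpotent. *)
Lemma aug_expn_pred : (v - 1) ^+ q.-1 = \sum_(i < q) v ^+ i.
Proof.
have X1_neq0 : 'X - 1 != 0 :> {poly F} by rewrite -polyC1 polyXsubC_eq0.
have: ('X - 1 : {poly F}) ^+ q.-1 = \sum_(i < q) 'X^i.
  by apply: (mulfI X1_neq0); rewrite -exprS prednK ?order_gt0 // -subrX1 aug_expn_poly.
move/(congr1 (horner_alg v)); rewrite rmorphXn rmorphB /= horner_algX rmorph1 => ->.
by rewrite rmorph_sum; apply: eq_bigr => i _; rewrite rmorphXn /= horner_algX.
Qed.

(** An element killed by [v - 1] is constant on the cosets of [U], hence a multiple of the sum of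
    the powers of [v], which is [(v - 1) ^+ q.-1]. *)
Lemma aug_ann c : inFG G c -> (v - 1) * c = 0 -> aug_mul q.-1 c.
Proof.
move=> Gc vc0.
have cu i x : c (u ^- i * x)%g = c x.
  have vc : v * c = c by apply: subr0_eq; rewrite -vc0 mulrBl mul1r.
  have -> : c (u ^- i * x)%g = (v ^+ i * c) x by rewrite -geltX gelt_mulE.
  by congr (_ x); elim: i => [|i IH]; rewrite ?mul1r // exprSr -mulrA vc.
(* The cofactor keeps one value of [c] per coset, at the chosen representative. *)
pose c0 : A := [ffun x => if grep (coset U x) == x then c x else 0].
have c0E x : c0 x = if grep (coset U x) == x then c x else 0 by exact: ffunE.
have Gc0 : inFG G c0 by move=> x /Gc cx; rewrite c0E cx if_same.
exists c0 => //; rewrite aug_expn_pred mulr_suml; apply/galgP=> x; rewrite galg_sum.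
have [Gx | nGx] := boolP (x \in G); last first.
  rewrite Gc // big1 // => i _; rewrite -geltX gelt_mulE c0E cu Gc // if_same //.
have [Gy yX] : grep (coset U x) \in G /\ coset U (grep (coset U x)) = coset U x.
  exact/grepP/mem_quotient.
set y := grep _ in Gy yX.
have cosetu i : coset U (u ^- i * x)%g = coset U x.
  rewrite morM ?groupV ?groupX // coset_id ?mul1g //.
  by rewrite groupV mem_cycle.
have : (x * y^-1)%g \in U.
  apply: coset_idr; first by rewrite (subsetP sub_norm_cycle) ?groupM ?groupV.
  by rewrite morM ?groupV // morphV ?(subsetP sub_norm_cycle) //= yX mulgV.
case/cyclePmin=> j ltj xy; rewrite (bigD1 (Ordinal ltj)) //= [X in _ + X]big1 => [|i].
  by rewrite -geltX gelt_mulE c0E cosetu cu -xy invMg invgK mulgKV eqxx addr0.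
rewrite -geltX gelt_mulE c0E cosetu cu -val_eqE /=.
move/negbTE=> neq_ij; case: eqP => // yi; case/eqP: neq_ij; apply/eqP.
have: (u ^+ i == u ^+ j)%g by rewrite -xy /y yi invMg invgK mulKVg.
by rewrite eq_expg_mod_order !modn_small.
Qed.


(* Induction on j: since [u - 1] is central, multiplication by N nilpotent central
   elements raises the (u - 1)-adic order of an element that is central modulo
   (u - 1) ^ j; the quotient by [u - 1] is again central modulo (u - 1) ^ (j - 1). *)
Lemma aug_filtration N f : gcentral G f -> f * f = f ->
  (forall s : seq A, size s = N -> (forall z, z \in s -> nilcentral G z) ->
    gquo (\prod_(z <- s) z * f) = 0) ->
  forall j (s : seq A) a, (j <= q)%N -> size s = (N * j)%N ->
    (forall z, z \in s -> nilcentral G z) -> inFG G a ->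
    (forall b, inFG G b -> aug_mul j (a * b - b * a)) ->
  aug_mul j (\prod_(z <- s) z * f * a).
Proof.
move=> Cf ff nilN; elim=> [|j IH] s a ltjq sz_s nil_s Ga ja.
  exists (\prod_(z <- s) z * f * a); rewrite ?expr0 ?mul1r //.
  apply: inFGM => //; apply: inFGM; last by case: Cf.
  by case: (gcentral_prod (fun z sz => proj1 (nil_s z sz))).
(* The last [N] factors produce one power of [v - 1]; the first [N * j] are left to the induction
   hypothesis. *)
pose s1 := take (N * j) s; pose s2 := drop (N * j) s.
have def_s : s = s1 ++ s2 by rewrite cat_take_drop.
have nil1 z : z \in s1 -> nilcentral G z by move/mem_take; apply: nil_s.
have nil2 z : z \in s2 -> nilcentral G z by move/mem_drop; apply: nil_s.
have sz1 : size s1 = (N * j)%N by rewrite size_takel // sz_s leq_mul2l leqnSn orbT.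
have sz2 : size s2 = N by rewrite size_drop sz_s mulnS addnK.
have C1 := gcentral_prod (fun z sz => proj1 (nil1 z sz)).
have C2 := gcentral_prod (fun z sz => proj1 (nil2 z sz)).
set t1 := \prod_(z <- s1) z in C1; set t2 := \prod_(z <- s2) z in C2.
have Ct : gcentral G (t2 * f) by apply: gcentralM.
have [a' Ga' def_a'] : aug_mul 1 (t2 * f * a).
  apply: gquo_eq0; first by apply: inFGM => //; case: Ct.
  by rewrite gquoM ?nilN ?mul0r //; case: Ct.
rewrite expr1 in def_a'.
(* Multiplying the commutator of [a'] and [b] by [v - 1] gives [t2 * f] times that of [a] and [b].
   So it equals [(v - 1) ^+ j * (t2 * f * c)] up to an element killed by [v - 1], which [aug_ann]
   puts in the ideal of [(v - 1) ^+ q.-1], and [j <= q.-1]. *)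
have ja' b : inFG G b -> aug_mul j (a' * b - b * a').
  move=> Gb; have [c Gc def_c] := ja b Gb.
  have [d Gd def_d] : aug_mul q.-1 (a' * b - b * a' - (v - 1) ^+ j * (t2 * f * c)).
    apply: aug_ann.
      apply: inFGB; first by apply: inFGB; apply: inFGM.
      by apply: inFGM; [apply: inFGX | apply: inFGM => //; case: Ct].
    have [GD CD] := Ct.
    rewrite mulrBr.
    have -> : (v - 1) * (a' * b - b * a') = t2 * f * (a * b - b * a).
      have := aug_comm 1 Gb; rewrite expr1 => vb.
      rewrite !mulrBr mulrA -def_a' [X in _ - X = _]mulrA vb -[b * _ * _]mulrA -def_a'.
      by rewrite [b * _]mulrA -CD // !mulrA.
    by rewrite [(v - 1) * (_ * _)]mulrA -exprS mulrA aug_comm // -[_ * c]mulrA -def_c subrr.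
  exists ((v - 1) ^+ (q.-1 - j) * d + t2 * f * c).
    apply: inFGD; apply: inFGM => //; first exact: inFGX.
    by case: Ct.
  rewrite mulrDr mulrA -exprD subnKC -?def_d ?subrK //.
  by rewrite -ltnS prednK ?order_gt0.
have [c Gc def_c] := IH s1 a' (ltnW ltjq) sz1 nil1 Ga' ja'.
exists c => //; rewrite exprS -[RHS]mulrA -def_c.
(* Idempotency of [f] supplies a copy of [f] to each of the two batches. *)
have -> : \prod_(z <- s) z * f * a = t1 * f * (t2 * f * a).
  rewrite def_s big_cat /= -/t1 -/t2 -{1}ff; case: Cf => _ Cf.
  by rewrite !mulrA -[t1 * f * t2]mulrA Cf ?mulrA //; case: C2.
rewrite def_a'.
have := aug_comm 1 (a := t1 * f); rewrite expr1 => cv; rewrite -/t1 mulrA -cv ?[RHS]mulrA //.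
by apply: inFGM; [case: C1 | case: Cf].
Qed.

(** By [aug_filtration] with [a = 1], the last [N * q.-1] factors times [f] give a multiple of
    [(v - 1) ^+ q.-1]; one more [v - 1] reaches [(v - 1) ^+ q = 0]. The surplus factors are
    central. *)
Lemma aug_kills_prod N f (s : seq A) : gcentral G f -> f * f = f ->
  (forall s : seq A, size s = N -> (forall z, z \in s -> nilcentral G z) ->
    gquo (\prod_(z <- s) z * f) = 0) ->
  (N * q.-1 <= size s)%N -> (forall z, z \in s -> nilcentral G z) ->
  (v - 1) * (\prod_(z <- s) z * f) = 0.
Proof.
move=> Cf ff nilN le_s nil_s; pose m := (size s - N * q.-1)%N.
have nil2 z : z \in drop m s -> nilcentral G z by move/mem_drop; apply: nil_s.
have nil1 z : z \in take m s -> nilcentral G z by move/mem_take; apply: nil_s.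
have [||c Gc] := aug_filtration Cf ff nilN (leq_pred q) _ nil2 (@inFG1 F gT G) _.
- by rewrite size_drop subKn.
- by move=> b Gb; exists 0; rewrite ?mul1r ?mulr1 ?subrr ?mulr0 //; apply: inFG0.
rewrite mulr1 -{2}(cat_take_drop m s) big_cat -mulrA => -> /=.
have [G1 _] := gcentral_prod (fun z sz => proj1 (nil1 z sz)).
rewrite mulrA -[v - 1]expr1 aug_comm // expr1 -mulrA [_ * (_ * c)]mulrA -exprS.
by rewrite prednK ?order_gt0 // aug_expn mul0r mulr0.
Qed.

End PElement.

End CentralQuotient.

(** * Defects and the main induction *)

Section Defect.
Variables (F : fieldType) (p : nat).
Hypothesis pF : p \in [pchar F].

(** Stands in for a defect group of order at most [p ^ d]. As a condition on the support of [e]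
    alone, it passes to centralizers and quotients without any discussion of their blocks. *)
Definition defect_le (gT : finGroupType) (G : {group gT}) (d : nat) (e : galg F gT) :=
  forall x (P : {group gT}), e x != 0 -> P \subset 'C_G[x]%g -> (p.-group P)%g ->
    (#|P| <= p ^ d)%N.

Definition defect_exp_le (gT : finGroupType) (G : {group gT}) (m : nat) (e : galg F gT) :=
  forall x u, e x != 0 -> u \in 'C_G[x]%g -> (p.-elt u)%g -> (#[u]%g <= p ^ m)%N.

(** The trivial exponent bound, used in the quotients, where only the order bound is carried
    along. *)
Lemma defect_le_exp (gT : finGroupType) (G : {group gT}) d (e : galg F gT) :
  defect_le G d e -> defect_exp_le G d e.
Proof.
by move=> le_d x u ex Cu pu; apply: (le_d x <[u]>%G) => //; rewrite cycle_subG.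
Qed.

(** The preimage [PP] of [P] acts by conjugation on the fibre over [X], so a non-zero coefficient at
    [X] yields a fixed [x] with [f x != 0]. Then [PP], of order [p ^ k * #|P|], centralizes [x] and
    has order at most [p ^ d]. *)
Lemma defect_le_gquo (gT : finGroupType) (G : {group gT}) (u : gT) (d k : nat)
    (f : galg F gT) :
  u \in G -> G \subset 'C[u]%g -> #[u]%g = (p ^ k)%N -> (k <= d)%N ->
  (forall x g, g \in G -> f (x ^ g)%g = f x) ->
  defect_le G d f -> defect_le (G / <[u]>)%G (d - k) (gquo G u f).
Proof.
move=> Gu cGu ou le_kd fJ le_d X P fX CP pP.
have p_pr := pcharf_prime pF.
have sUG : <[u]>%g \subset G by rewrite cycle_subG.
have nUG := sub_norm_cycle cGu.
have nsUG : (<[u]> <| G)%g by rewrite /(_ <| _)%g sUG.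
pose S := [set x in G | coset <[u]>%g x == X].
pose PP := (coset <[u]>%g @*^-1 P)%G.
have cPP : #|PP| = (p ^ k * #|P|)%N by rewrite card_cosetpre -orderE ou.
have pPP : (p.-group PP)%g by rewrite /pgroup cPP pnatM pnatX pnat_id ?pP //.
have sPPG : PP \subset G.
  by rewrite -(quotientGK nsUG) morphpreS // (subset_trans CP) ?subsetIl.
have : gquo G u f X = \sum_(x in S) f x.
  by rewrite gquoE; apply: eq_bigl => x; rewrite inE.
rewrite (sum_pgroup_fix (p := p) (to := 'J%act) (P := PP)) //.
- have [x | fix0] := pickP (fun x => (x \in 'Fix_(S | 'J)(PP)%g) && (f x != 0)).
    case/andP=> /setIP[Sx fixx] fx _.
    have sPC : PP \subset 'C_G[x]%g.
      by rewrite subsetI sPPG -cent_set1 centsC sub1set -afixJ.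
    have := le_d x PP fx sPC pPP.
    by rewrite cPP -[in X in (_ <= X)%N](subnKC le_kd) expnD leq_pmul2l ?expn_gt0 ?prime_gt0.
  rewrite big1 => [f0|x fixx]; first by rewrite f0 eqxx in fX.
  by have := fix0 x; rewrite fixx /= => /negbFE/eqP.
- apply/actsP=> g PPg x; rewrite !inE /=.
  have Gg := subsetP sPPG _ PPg.
  rewrite groupJr //; case Gx: (x \in G) => //=.
  rewrite morphJ ?(subsetP nUG) //.
  have /(subsetP CP)/setIP[_ /cent1P cgX] : coset <[u]>%g g \in P.
    by case/morphpreP: PPg.
  rewrite -{1}(_ : (X ^ coset <[u]> g = X)%g) ?(inj_eq (conjg_inj _)) //.
  by apply/conjg_fixP/commgP/commute_sym.
by move=> x g _ PPg /=; rewrite fJ ?(subsetP sPPG).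
Qed.

(** Stated for any central idempotent, since the induction meets images of [e] that may be zero or
    decomposable. *)
Theorem nilcentral_prod_eq0 (gT : finGroupType) (G : {group gT}) (d m : nat)
    (e : galg F gT) (s : seq (galg F gT)) :
  gcentral G e -> e * e = e -> defect_le G d e -> defect_exp_le G m e ->
  size s = (p ^ d - p ^ (d - m) + 1)%N -> (forall z, z \in s -> nilcentral G z) ->
  \prod_(z <- s) z * e = 0.
Proof.
have p_pr := pcharf_prime pF; have p_gt0 := prime_gt0 p_pr.
have [n] := ubnP #|G|; elim: n gT G d m e s => // n IH gT G d m e s.
rewrite ltnS => leGn Ce ee le_d le_m; rewrite addn1; case: s => // z s [sz_s] nil_s.
(* The [+ 1] in the length pays for [z], which kills [w] once [w] is constant on p-sections. *)
have [Cz [N zN]] := nil_s z (mem_head _ _).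
have {}nil_s y : y \in s -> nilcentral G y by move=> sy; apply: nil_s; rewrite inE sy orbT.
have C_s y : y \in s -> gcentral G y by case/nil_s.
pose w := \prod_(y <- s) y * e.
have Cw : gcentral G w by apply: gcentralM => //; apply: gcentral_prod.
have Gw : inFG G w by case: Cw.
rewrite big_cons -mulrA -/w; apply: (nilpotent_mul_section_stable pF Cz zN Gw).
split=> [x g _ Gg | u x Gu Gx pu cxu]; first by case/gcentralP: Cw => _ ->.
have [-> | nt_u] := eqVneq u 1%g; first by rewrite mul1g.
have Cx : x \in 'C_G[u]%g by rewrite inE Gx; apply/cent1P.
have Cu : u \in 'C_G[u]%g by rewrite inE Gu; apply/cent1P.
have cC : 'C_G[u]%g \subset 'C[u]%g by apply: subsetIr.
pose f := gres 'C[u]%g e.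
have Cf : gcentral 'C_G[u] f by apply: gcentral_gres.
have ff : f * f = f by rewrite /f -(gcentral_gresM pF Gu) ?ee.
pose s' := map (gres 'C[u]%g) s.
have def_w' : gres 'C[u]%g w = \prod_(y <- s') y * f.
  by rewrite (gcentral_gresM pF Gu) ?(gres_prod pF Gu) //; apply: gcentral_prod.
have nil_s' y : y \in s' -> nilcentral 'C_G[u] y.
  case/mapP=> y0 /nil_s[Cy0 [k y0k]] ->; split; first exact: gcentral_gres.
  by exists k; rewrite -(gresX pF Gu) // y0k; apply/galgP=> t; rewrite gresE galg0 if_same.
have wE y : y \in 'C_G[u]%g -> w y = (\prod_(y <- s') y * f) y.
  by case/setIP=> _ Cy; rewrite -def_w' gresE Cy.
(* If [f = 0] then [w] vanishes on ['C_G[u]]; otherwise a point of its support bounds [k] by both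
   [m] and [d]. *)
have [f0 | [x0 fx0]] : f = 0 \/ exists x, f x != 0.
  have [t ft | f0] := pickP (fun t => f t != 0); [by right; exists t | left].
  by apply/galgP=> t; rewrite galg0; apply/eqP/negbFE/f0.
  by rewrite !wE ?groupM // f0 mulr0 !galg0.
have Cux0 : x0 \in 'C[u]%g by move: fx0; rewrite gresE; case: ifP; rewrite ?eqxx.
have ex0 : e x0 != 0 by move: fx0; rewrite gresE Cux0.
have Cx0u : u \in 'C_G[x0]%g by rewrite inE Gu cent1C.
have [k ou] := p_natP pu.
have le_km : (k <= m)%N.
  by rewrite -(leq_exp2l _ _ (prime_gt1 p_pr)) -ou; apply: le_m Cx0u pu.
have le_kd : (k <= d)%N.
  by rewrite -(leq_exp2l _ _ (prime_gt1 p_pr)) -ou; apply: (defect_le_exp le_d) Cx0u pu.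
have le_f : defect_le 'C_G[u] d f.
  move=> y P fy sPC pP; apply: (le_d y) => //.
    by move: fy; rewrite gresE; case: ifP; rewrite ?eqxx.
  by rewrite (subset_trans sPC) // setSI ?subsetIl.
have vw0 : (gelt F u - 1) * (\prod_(y <- s') y * f) = 0.
  apply: (aug_kills_prod Cu cC pF pu (N := p ^ (d - k)) Cf ff) => //; last first.
    (* [p ^ (d - k) * (p ^ k - 1)] is [p ^ d - p ^ (d - k)], at most [p ^ d - p ^ (d - m)] because
       [k <= m]. *)
    rewrite size_map sz_s ou mulnC -subn1 mulnBl mul1n -expnD subnKC //.
    by apply: leq_sub2l; rewrite leq_exp2l ?prime_gt1 // leq_sub2l.
  move=> t sz_t nil_t.
  have Ct y : y \in t -> gcentral 'C_G[u] y by case/nil_t.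
  rewrite gquoM //; [|by case: (gcentral_prod Ct) | by case: Cf].
  rewrite gquo_prod // => [|y /Ct[]//].
  have le_g : defect_le ('C_G[u] / <[u]>)%G (d - k) (gquo 'C_G[u] u f).
    by apply: defect_le_gquo => // g h Cg; case/gcentralP: Cf => _; apply.
  (* With [d - k] for both order and exponent the required length is
     [p ^ (d - k) - p ^ 0 + 1 = p ^ (d - k)]; the group is smaller since [u] is not 1. *)
  apply: IH (le_g) (defect_le_exp le_g) _ _.
  - apply: leq_trans leGn; apply: leq_trans (subset_leq_card (subsetIl G 'C[u]%g)).
    by rewrite ltn_quotient ?cycle_eq1 // cycle_subG.
  - exact: gcentral_gquo.
  - by rewrite -gquoM ?ff //; case: Cf.
  - by rewrite size_map sz_t subnn expn0 subnK // expn_gt0 p_gt0.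
  move=> _ /mapP[y /nil_t[Cy [j yj]] ->]; split; first exact: gcentral_gquo.
  by exists j; rewrite -gquoX ?yj ?raddf0 //; case: Cy.
(* The coefficient of [vw0] at [u * x] is the difference of the values at [x] and at [u * x]. *)
rewrite -[in RHS](mulKg u x) !wE ?groupM ?groupV //.
move/galgP/(_ (u * x)%g): vw0; rewrite mulrBl mul1r galgB gelt_mulE galg0.
by move/subr0_eq.
Qed.

End Defect.

(** * Defect groups, the radical and the Loewy length *)

Section RelTrace.
Variables (F : fieldType) (p : nat) (gT : finGroupType) (G D : {group gT}).
Hypothesis pF : p \in [pchar F].

(** The inverse turns left translation of cosets into a right action. *)
Definition lcoset_act (C : {set gT}) (g : gT) : {set gT} := (g^-1 *: C)%g.

Fact lcoset_act1 : lcoset_act^~ 1%g =1 id.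
Proof. by move=> C; rewrite /lcoset_act invg1 mul1g. Qed.

Fact lcoset_actM C : act_morph lcoset_act C.
Proof. by move=> g h; rewrite /lcoset_act invMg -mulg_set1 mulgA. Qed.

Definition lcoset_action := TotalAction lcoset_act1 lcoset_actM.

(** [P] permutes the left cosets of [D] in [G] and, centralizing [x], preserves the summands of the
    trace at [x]. A non-zero value therefore forces a fixed coset [h *: D], which means that
    [P :^ h] lies in [D]. *)
Lemma in_rel_trace_conj (e : galg F gT) x (P : {group gT}) :
  in_rel_trace G D e -> e x != 0 -> P \subset 'C_G[x]%g -> (p.-group P)%g ->
  exists h, (P :^ h)%g \subset D.
Proof.
move=> [a [[_ aD] ->]] ex sPC pP.
have aJ y d : d \in D -> a (y ^ d)%g = a y.
  by move=> Dd; rewrite -{2}(aD d Dd) ffunE.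
pose W (C : {set gT}) : F := a (x ^ repr C)%g.
have WE h : W (h *: D)%g = a (x ^ h)%g.
  have /lcosetP[d Dd eq_h] : repr (h *: D)%g \in (h *: D)%g by apply/mem_repr/lcoset_refl.
  by rewrite /W eq_h conjgM aJ.
have actE h g : lcoset_act (h *: D)%g g = ((g^-1 * h) *: D)%g.
  by rewrite /lcoset_act mulgA mulg_set1.
move: ex; rewrite ffunE.
rewrite (sum_pgroup_fix (p := p) (to := lcoset_action) (P := P) (W := W)) //.
- have [C /setIP[/lcosetsP[h Gh ->] /afixP fixC] _ | fix0] :=
      pickP (mem 'Fix_(lcosets D G | lcoset_action)(P)%g).
    exists h; apply/subsetP=> _ /imsetP[g Pg ->].
    have: ((g^-1 * h) *: D = h *: D)%g by rewrite -actE; apply: fixC.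
    move/lcoset_eqP; rewrite mem_lcoset => Dg.
    by rewrite -groupV -conjVg conjgE.
  by rewrite big_pred0 ?eqxx.
- apply/actsP=> g /(subsetP sPC)/setIP[Gg _] C; rewrite /=.
  apply/lcosetsP/lcosetsP=> -[h Gh].
    move=> def_h; exists (g * h)%g; first exact: groupM.
    by rewrite -mulg_set1 -mulgA -def_h /lcoset_act mulgA mulg_set1 mulgV mul1g.
  by move=> ->; exists (g^-1 * h)%g; rewrite ?groupM ?groupV.
move=> _ g /lcosetsP[h Gh ->] /(subsetP sPC)/setIP[_ /cent1P cgx].
rewrite /= actE !WE conjgM; congr (a (_ ^ _)%g).
by apply/conjg_fixP/commgP/commuteV/commute_sym.
Qed.

Lemma in_rel_trace_defect_le d (e : galg F gT) : #|D| = (p ^ d)%N ->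
  in_rel_trace G D e -> defect_le p G d e.
Proof.
move=> oD trD x P ex sPC pP; have [h sPhD] := in_rel_trace_conj trD ex sPC pP.
by rewrite -oD -(cardJg P h) subset_leq_card.
Qed.

Lemma in_rel_trace_defect_exp_le m (e : galg F gT) : exponent D = (p ^ m)%N ->
  in_rel_trace G D e -> defect_exp_le p G m e.
Proof.
move=> expD trD x u ex Cu pu.
have [|h suD] := in_rel_trace_conj (P := <[u]>%G) trD ex _ pu; first by rewrite cycle_subG.
rewrite -(orderJ u h) dvdn_leq ?expn_gt0 ?prime_gt0 ?(pcharf_prime pF) //.
by rewrite -expD dvdn_exponent // (subsetP suD) // memJ_conjg cycle_id.
Qed.

End RelTrace.

(** * Nilpotency of the radical of the center of the block *)

(** There is one vector more than the dimension. Exponents start at 1 because, for [x] in the block,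
    [e] absorbs the positive powers, whereas [x ^+ 0] is the identity of the whole algebra. *)
Lemma galg_algebraic (F : fieldType) (gT : finGroupType) (x : galg F gT) :
  ~~ free [tuple x ^+ i.+1 | i < (dim (galg F gT)).+1].
Proof.
apply/negP=> /eqP fx; have := dimvS (subvf <<[tuple x ^+ i.+1 | i < (dim (galg F gT)).+1]>>).
by rewrite fx size_tuple dimvf ltnn.
Qed.

(** In a linear relation between positive powers of [x], the term of lowest degree factors out as
    [x ^+ i.+1 * (e - y * x) = 0]; since [e - y * x] is a unit of the center of the block,
    [x ^+ i.+1 = 0]. *)
Lemma inJZB_nilcentral (F : fieldType) (gT : finGroupType) (G : {group gT})
    (e x : galg F gT) :
  gcentral G e -> e * e = e -> inJZB G e x -> nilcentral G x.
Proof.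
move=> Ce ee [[Cx xe] unit_x]; split=> //; apply: NNPP => not_nil.
have{not_nil} xn0 n : x ^+ n != 0 by apply/eqP=> xn; apply: not_nil; exists n.
have [Gx _] := Cx; case: (Ce) => Ge cG_e.
case/negP: (galg_algebraic x); apply/freeP=> k sum0.
have{}sum0 : \sum_i k i *: x ^+ i.+1 = 0.
  by rewrite -[RHS]sum0; apply: eq_bigr => i _; rewrite (nth_mktuple _ _ i).
suff kz m (i : 'I__) : (i < m)%N -> k i = 0 by move=> i; apply: (kz _ i (ltn_ord i)).
elim: m i => // m IH i; rewrite ltnS => le_im; apply/eqP/idPn=> ki.
(* The higher terms of the relation, divided by [- k i] and by [x ^+ i.+2]; the factor [e] puts [y]
   in the block. *)
pose y : galg F gT := - \sum_(j : 'I__ | (i < j)%N) (k j / k i) *: (x ^+ (j - i.+1) * e).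
have Cy : inZB G e y.
  split; last first.
    rewrite [LHS](_ : _ = y * e) // mulNr mulr_suml; congr (- _).
    by apply: eq_bigr => j _; rewrite -scalerAl -mulrA [e * e]ee.
  rewrite /y -scaleN1r; apply/gcentralZ; apply: big_ind => [||j _].
  - exact: gcentral0.
  - by move=> b c; apply: gcentralD.
  by apply/gcentralZ/gcentralM => //; apply: gcentralX.
have [z [[Cz _] ez]] := unit_x y Cy.
have x_e n : x ^+ n.+1 * e = x ^+ n.+1 by rewrite exprSr -mulrA [x * e]xe.
have eyx : x ^+ i.+1 * (e - y * x) = 0.
  rewrite mulrBr x_e mulNr !mulrN opprK mulr_suml mulr_sumr.
  apply: (scalerI ki); rewrite scaler0 -[RHS]sum0 scalerDr scaler_sumr.
  rewrite [RHS](bigID (fun j : 'I_ _ => (i < j)%N)) /= addrC; congr (_ + _); last first.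
    apply: eq_bigr => j ltij; rewrite -scalerAl -scalerAr scalerA [k i * _]mulrC divfK //.
    have ex : e * x = x by rewrite cG_e.
    by rewrite -mulrA ex -exprSr -exprD -subSn // addSn subnKC // ltnW.
  rewrite (bigD1 i) ?ltnn //= big1 ?addr0 // => j /andP[nltij neq_ji].
  rewrite IH ?scale0r //; apply: leq_trans le_im.
  by rewrite ltn_neqAle val_eqE neq_ji leqNgt.
have def_e : e = (e - y * x) * z.
  rewrite -{1}ez (_ : gsub _ _ = e - y * x) //.
  by apply/galgP=> t; rewrite galgB ffunE.
by have /eqP[] := xn0 i.+1; rewrite -x_e def_e mulrA eyx mul0r.
Qed.

(** Classical, since the vanishing of powers of the radical is a [Prop] and not a boolean. *)
Lemma ex_min_nat (P : nat -> Prop) n : P n ->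
  exists2 m, P m /\ (m <= n)%N & forall k, P k -> (m <= k)%N.
Proof.
elim/ltn_ind: n => n IH Pn.
have [[k [Pk ltkn]] | min_n] := classic (exists k, P k /\ (k < n)%N).
  have [m [Pm le_mk] min_m] := IH k ltkn Pk.
  by exists m => //; split=> //; apply: leq_trans le_mk (ltnW ltkn).
exists n => // k Pk; rewrite leqNgt; apply/negP=> ltkn.
by apply: min_n; exists k.
Qed.

Theorem theorem1p3 (p : nat) (F : closedFieldType) (gT : finGroupType)
    (G : {group gT}) (e : {ffun gT -> F}) (D : {group gT}) (d eps : nat) :
  prime p -> p \in [pchar F] ->
  block_idem G e -> defect_group G e D ->
  #|D| = (p ^ d)%N -> exponent D = (p ^ eps)%N ->
  exists n : nat, is_LL_ZB G e n /\ (n <= p ^ d - p ^ (d - eps) + 1)%N.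
Proof.
move=> p_pr pF [Ce ee _ _] [_ trD _] oD expD.
set n := (p ^ d - p ^ (d - eps) + 1)%N.
have JZB0 : JZB_pow_zero G e n.
  move=> s sz_s Js.
  have nil_s z : z \in s -> nilcentral G z by move/Js; apply: inJZB_nilcentral Ce ee.
  have -> : foldr (@gmul F gT) (gone F gT) s = \prod_(z <- s) (z : galg F gT).
    by elim: (s) => [|z s' IH]; rewrite ?big_nil // big_cons /= IH.
  have := nilcentral_prod_eq0 pF Ce ee (in_rel_trace_defect_le pF oD trD)
            (in_rel_trace_defect_exp_le pF expD trD) sz_s nil_s.
  have -> : gzero F gT = (0 : galg F gT) by apply/galgP=> t; rewrite galg0.
  (* The product absorbs [e] through its first factor, which exists because [n] is positive. *)
  move=> <-; move: sz_s Js nil_s; rewrite /n addn1.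
  case: s => // z s _ Js nil_s; rewrite big_cons.
  have Cs y : y \in s -> gcentral G y by move=> sy; case: (nil_s y); rewrite ?inE ?sy ?orbT.
  have [_ cs] := gcentral_prod Cs; case: Ce => Ge _.
  have [[_ ze] _] := Js z (mem_head _ _).
  by rewrite -mulrA cs // mulrA (ze : (z : galg F gT) * e = z).
have [m [[m_gt0 Jm] le_mn] min_m] :=
  ex_min_nat (P := fun m => (1 <= m)%N /\ JZB_pow_zero G e m) (conj (leq_addl _ 1) JZB0).
by exists m; split=> //; split=> // k k_gt0 Jk; apply: min_m.
Qed.
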